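(* Let $Y_n$ be the number of summands in the (unique) Kentucky-2 legal decomposition of an integer chosen uniformly at random from $[0,a_{2n+1})\cap\mathbb{Z}$. Let $\mu_n$ and $\sigma_n^2$ be the mean and variance of $Y_n$. Then \[ \mu_n=\frac n3+\frac29+O\!\left(\frac{n}{2^n}\right),\qquad \sigma_n^2=\frac{2n}{27}+\frac{8}{81}+O\!\left(\frac{n^2}{2^n}\right), \] and $Y_n'=(Y_n-\mu_n)/\sigma_n$ converges in distribution to the standard normal distribution as $n\to\infty$.
   Context: The Kentucky-2 sequence $(a_n)_{n\ge1}$: index $\ell$ belongs to bin $\lceil \ell/2\rceil$. A legal decomposition of $m\ge0$ using $\{a_1,\dots,a_N\}$ is $m=a_{\ell_1}+\cdots+a_{\ell_k}$, $k\ge0$, $1\le\ell_1<\cdots<\ell_k\le N$, with $\lceil \ell_{j+1}/2\rceil-\lceil \ell_j/2\rceil\ge2$ for all $j$. The sequence is defined by $a_1=1$ and, for $N\ge1$, $a_{N+1}$ is the smallest positive integer with no legal decomposition using $\{a_1,\dots,a_N\}$ (first terms $1,2,3,4,5,8,11,16,\dots$). Every nonnegative integer has a unique legal decomposition (the decomposition of $0$ is empty, with $0$ summands). *)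

(* Defs.v *)
From HB Require Import structures.
From mathcomp Require Import all_boot all_order all_algebra.
From mathcomp Require Import all_classical all_reals all_analysis.
From mathcomp Require Import measurable_realfun.

Set Implicit Arguments.
Unset Strict Implicit.
Unset Printing Implicit Defensive.

Import Order.TTheory GRing.Theory Num.Theory.
Import numFieldNormedType.Exports.

Local Open Scope classical_set_scope.
Local Open Scope ring_scope.

(* [uphalf l] is the ceiling of [l / 2]. *)
Definition bin (l : nat) : nat := uphalf l.

(* A decomposition is the list [l_1 < ... < l_k] of its indices. *)
Definition legal (s : seq nat) : bool :=
  [&& all (leq 1) s, sorted ltn s
    & sorted (fun i j => (bin i + 2 <= bin j)%N) s].

Definition legal_decomposition (a : nat -> nat) (m : nat) (s : seq nat) : Prop :=
  legal s /\ m = (\sum_(l <- s) a l)%N.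

Definition decomposable (a : nat -> nat) (N m : nat) : Prop :=
  exists2 s, legal_decomposition a m s & all (fun l => l <= N)%N s.

(* The sequence is indexed from 1: the value [a 0] plays no role. *)
Definition kentucky2 (a : nat -> nat) : Prop :=
  a 1%N = 1%N /\
  forall N, (1 <= N)%N ->
    [/\ (0 < a N.+1)%N, ~ decomposable a N (a N.+1)
      & forall m, (0 < m)%N -> (m < a N.+1)%N -> decomposable a N m].

Lemma decomposable_eq (a b : nat -> nat) (N m : nat) :
  (forall i, (i <= N)%N -> a i = b i) -> decomposable a N m -> decomposable b N m.
Proof.
move=> ab [s [ls ->] sN]; exists s => //; split => //.
by apply: eq_big_seq => i /(allP sN); exact: ab.
Qed.

Lemma decomposable_le (a : nat -> nat) (N m : nat) :
  decomposable a N m -> (m <= \sum_(i <- iota 0 N.+1) a i)%N.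
Proof.
move=> [s [/and3P[_ s_lt _] ->] sN].
have us : uniq s by apply: sorted_uniq s_lt; [exact: ltn_trans | exact: ltnn].
apply: (uniq_sub_le_big (le := leq)) => //.
- by move=> x y; exact: leq_addr.
- exact: iota_uniq.
- by move=> i /(allP sN) iN; rewrite mem_iota add0n.
Qed.

Lemma least_not_decomposable (a : nat -> nat) (N : nat) :
  exists m, [/\ (0 < m)%N, ~ decomposable a N m
    & forall k, (0 < k)%N -> (k < m)%N -> decomposable a N k].
Proof.
pose p m := (0 < m)%N && ~~ `[< decomposable a N m >].
have exp : exists m, p m.
  exists (\sum_(i <- iota 0 N.+1) a i).+1%N; rewrite /p /=.
  by apply/asboolPn => /decomposable_le; rewrite ltnn.
case: (ex_minnP exp) => m /andP[m0 /asboolPn mN] mmin; exists m; split => //.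
move=> k k0 km; apply: contrapT => kN.
have := mmin k; rewrite /p k0 /= leqNgt km => /(_ _)/negP.
by case=> //; exact/asboolPn.
Qed.

Lemma kentucky2_exists : exists a, kentucky2 a.
Proof.
have [next nextP] := choice
  (fun sN : seq nat * nat => least_not_decomposable (nth 0%N sN.1) sN.2).
pose pre := nat_rect (fun=> seq nat) [:: 0%N; 1%N]
  (fun N s => rcons s (next (s, N.+1))).
have preS N : pre N.+1 = rcons (pre N) (next (pre N, N.+1)) by [].
have size_pre N : size (pre N) = N.+2.
  by elim: N => // N IH; rewrite preS size_rcons IH.
have nth_pre N i : (i <= N.+1)%N -> nth 0%N (pre N) i = nth 0%N (pre i) i.
  elim: N => [|N IH]; first by case: i => [|[|]].
  rewrite leq_eqVlt => /predU1P[->|iN].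
    by rewrite [in RHS]preS nth_rcons size_pre ltnSn.
  by rewrite preS nth_rcons size_pre iN; exact: IH.
exists (fun N => nth 0%N (pre N) N); split => // -[//|N] _.
have -> : nth 0%N (pre N.+2) N.+2 = next (pre N, N.+1).
  by rewrite -(nth_pre N.+1)// preS nth_rcons size_pre ltnn eqxx.
have [h1 h2 h3] := nextP (pre N, N.+1).
split => //.
- by move=> h; apply: h2; apply: decomposable_eq h => i iN /=; rewrite nth_pre.
- by move=> m m0 /(h3 _ m0); apply: decomposable_eq => i iN /=; exact: nth_pre.
Qed.

(* The legal decomposition of [m]; its uniqueness makes the choice immaterial. *)
Definition the_decomposition (a : nat -> nat) (m : nat) : seq nat :=
  xget [::] [set s | legal_decomposition a m s].

Definition num_summands (R : realType) (a : nat -> nat) (m : nat) : R :=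
  (size (the_decomposition a m))%:R.

HB.instance Definition _ (R : realType) (a : nat -> nat) :=
  isMeasurableFun.Build _ _ nat R (num_summands R a) (fun _ _ _ => I).

(* For [N > 0], the uniform probability on [{0, ..., N - 1}]
   (the junk value at [N = 0] is the Dirac mass at [0]). *)
Definition uniform_below (R : realType) (N : nat) : probability nat R :=
  mnormalize (msum (fun k : nat => \d_k) N) \d_0%N.

Lemma uniform_belowE (R : realType) (N : nat) (A : set nat) : (0 < N)%N ->
  uniform_below R N A =
  ((\sum_(k < N) (nat_of_ord k \in A)%:R) / N%:R)%:E.
Proof.
move=> N0; rewrite /uniform_below.
set m := (X in mnormalize X _).
have E B : m B = (\sum_(k < N) (nat_of_ord k \in B)%:R)%:E.
  rewrite -sumEFin [LHS]/(msum _ _ _) /msum.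
  by apply: eq_bigr => k _; exact: diracE.
have ET : m [set: nat] = N%:R%:E.
  by rewrite E; under eq_bigr do rewrite in_setT; rewrite sumr_const card_ord.
rewrite [LHS]/(mnormalize _ _ _) /mnormalize ET eqe pnatr_eq0 gtn_eqF //=.
by rewrite E -EFinM.
Qed.

Definition mean d (T : measurableType d) (R : realType) (P : probability T R)
    (X : {RV P >-> R}) : R := fine 'E_P[X].
Arguments mean {d T R} P X.

Definition var d (T : measurableType d) (R : realType) (P : probability T R)
    (X : {RV P >-> R}) : R := fine 'V_P[X].
Arguments var {d T R} P X.

Definition standardized d (T : measurableType d) (R : realType)
    (P : probability T R) (X : {RV P >-> R}) (t : T) : R :=
  (X t - mean P X) / Num.sqrt (var P X).
Arguments standardized {d T R} P X t.

Section standardized_measurable.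
Context d (T : measurableType d) (R : realType) (P : probability T R).
Variable X : {RV P >-> R}.

Lemma measurable_standardized : measurable_fun [set: T] (standardized P X).
Proof.
apply: measurable_funM; last exact: measurable_cst.
by apply: measurable_funB; [exact: measurable_funPT | exact: measurable_cst].
Qed.

HB.instance Definition _ :=
  isMeasurableFun.Build _ _ T R (standardized P X) measurable_standardized.

End standardized_measurable.

Definition cvg_in_distribution d (T : measurableType d) (R : realType)
    (P : nat -> probability T R) (X : forall n, {RV (P n) >-> R})
    (Q : probability (measurableTypeR R) R) : Prop :=
  forall x : R, {for x, continuous (fun y : R => Q `]-oo, y]%classic)} ->
    cdf (X n) x @[n --> \oo] --> Q `]-oo, x]%classic.
Arguments cvg_in_distribution {d T R} P X Q.

(* Main.v *)
(** Listing the legal index sets bin by bin, and adding for each new index its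
    value to the list of sums already obtained, produces the interval
    [0, a_(2n+1)) in increasing order.  Hence decompositions are unique, and the
    number p(n,k) of integers below a_(2n+1) with k summands obeys
    p(n+2,k+1) = p(n+1,k+1) + 2 p(n,k), i.e. p(n,k) = 2^k C(n+1-k,k).  The same
    recurrence gives closed forms for the first two moments, whence the mean and
    the variance.

    The limit law needs neither Stirling's formula nor characteristic functions.
    With z_k = (k - n/3) / sqrt(2n/27), the ratio p(n,k+1) / p(n,k) agrees with
    the ratio of the Gaussian weights exp(-z^2/2) up to a factor exp(O(1/n)) as
    long as |z_k| <= T, so p(n,k) is proportional to the normal mass of
    ]z_k, z_(k+1)] up to a factor exp(O(1/sqrt n)), uniformly in that window.
    Chebyshev's inequality bounds the mass outside the window, which pins down the
    proportionality constant and yields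
    liminf P(x <= z(Y_n) < y) >= Phi(y) - Phi(x).  Applying this lower bound to a
    half-line and to its complement gives convergence of the distribution
    functions. *)
Require Import Defs.
From HB Require Import structures.
From mathcomp Require Import all_boot all_order all_algebra.
From mathcomp Require Import all_classical all_reals all_analysis.
From mathcomp Require Import measurable_realfun.
From mathcomp Require Import zify ring lra.

Import Order.TTheory GRing.Theory Num.Theory.
Import numFieldNormedType.Exports.

Local Open Scope classical_set_scope.
Local Open Scope ring_scope.

(** * Enumeration of legal index lists, uniqueness of decompositions, and counts by size *)

Section Decompositions.
Local Open Scope nat_scope.

(* An index of bin [m.+1] may only follow indices of the first [m.-1] bins; for
   [m = 0] the truncation is harmless, since [legals 0] is the empty list alone. *)
Fixpoint legals (n : nat) : seq (seq nat) :=
  if n is m.+1 then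
    (legals m ++ [seq rcons s m.*2.+1 | s <- legals m.-1])
      ++ [seq rcons s m.*2.+2 | s <- legals m.-1]
  else [:: [::]].

Definition enumerates (L : seq (seq nat)) (N : nat) : Prop :=
  forall s, (s \in L) = legal s && all (leq^~ N) s.

Definition value (a : nat -> nat) (s : seq nat) : nat := \sum_(l <- s) a l.

(** Both orders in [legal] are transitive, so sortedness is a pairwise condition and the last index
    can be split off. The bin gap already forces strict increase. *)
Lemma legal_rcons (s : seq nat) (l : nat) :
  legal (rcons s l) =
  [&& legal s, 0 < l & all (fun i => bin i + 2 <= bin l) s].
Proof.
rewrite /legal /bin.
have tb : transitive (fun i j => uphalf i + 2 <= uphalf j) by move=> i j k; lia.
rewrite !(sorted_pairwise ltn_trans) !(sorted_pairwise tb) !pairwise_rcons all_rcons.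
have [H|] := boolP (all (fun i => uphalf i + 2 <= uphalf l) s); last first.
  by rewrite !andbF.
have -> : all (ltn^~ l) s by apply: sub_all H => i /=; lia.
by rewrite /= !andbT; case: (0 < l); rewrite ?andbF ?andbT.
Qed.

Lemma enumerates_nil : enumerates [:: [::]] 0.
Proof.
case=> [//|i s]; rewrite inE /=; apply/esym/negP => /andP[].
by rewrite /legal /= -andbA => /and3P[i0 _ _] /andP[]; rewrite leqNgt i0.
Qed.

(** A legal list bounded by [N.+1] either avoids [N.+1] or ends with it. In the second case its
    other indices lie at least two bins earlier, which the hypothesis on [M] turns into the bound
    [M]. *)
Lemma enumerates_step (L L' : seq (seq nat)) (N M : nat) :
  (forall i, 0 < i -> (i <= M) = (bin i + 2 <= bin N.+1)) ->
  enumerates L N -> enumerates L' M ->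
  enumerates (L ++ [seq rcons s N.+1 | s <- L']) N.+1.
Proof.
move=> MN LN LM s; rewrite mem_cat LN; case/lastP: s => [|s l].
  by rewrite /legal /=.
rewrite !all_rcons.
have -> : (rcons s l \in [seq rcons s N.+1 | s <- L']) = (l == N.+1) && (s \in L').
  apply/mapP/andP => [[t tL' /rcons_inj[-> ->]]|[/eqP-> sL']]; first by rewrite eqxx.
  by exists s.
rewrite LM legal_rcons.
have [lN|lN|->] := ltngtP l N.+1.
- have -> : l <= N by lia.
  rewrite orbF /=; case Hb : (all _ _); last by rewrite !andbF.
  rewrite !andbT; case: (legal s); case: (0 < l) => //=.
  have H (K : nat) : l <= K.+1 -> all (leq^~ K) s.
    by move=> lK; apply: sub_all Hb => i /=; move: lN; rewrite /bin; lia.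
  rewrite (H N) ?(H N.+1) ?andbT//; lia.
- have /negbTE-> : ~~ (l <= N) by lia.
  by rewrite !andbF.
- rewrite ltnn /= !andbF /= ?andbT.
  case ls : (legal s) => //=.
  have s0 : {in s, forall i, 0 < i} by apply/allP; case/and3P: ls.
  have -> : all (fun i => bin i + 2 <= bin N.+1) s = all (leq^~ M) s.
    by apply: eq_in_all => i /s0 i0; rewrite MN.
  case H : (all _ _) => //=; apply/esym/allP => i si.
  by have := allP H i si; rewrite /= (MN _ (s0 _ si)) /bin; lia.
Qed.

(** The values of [L] are exactly the decomposable integers, so when they fill [[0, X)] the least
    integer missed is [X]. *)
Lemma kentucky2_next (a : nat -> nat) (N X : nat) (L : seq (seq nat)) :
  kentucky2 a -> 0 < N -> enumerates L N ->
  map (value a) L = iota 0 X -> 0 < X -> a N.+1 = X.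
Proof.
move=> [_ /(_ N)] H /H[aN aNd aNmin] LN LX X0.
have decE m : decomposable a N m <-> m < X.
  rewrite -[m < X](mem_iota 0 X m) -LX; split => [[s [ls ->] sN]|/mapP[s]].
    by apply/mapP; exists s; rewrite // LN ls.
  by rewrite LN => /andP[ls sN] ->; exists s.
apply/eqP; rewrite eqn_leq; apply/andP; split.
  by rewrite leqNgt; apply/negP => /aNmin -/(_ X0) /decE; rewrite ltnn.
by rewrite leqNgt; apply/negP => /decE.
Qed.

Lemma value_rcons (a : nat -> nat) (s : seq nat) (l : nat) :
  value a (rcons s l) = a l + value a s.
Proof. by rewrite /value -cats1 big_cat big_seq1 addnC. Qed.

Lemma value_map_rcons (a : nat -> nat) (L : seq (seq nat)) (l X : nat) :
  map (value a) L = iota 0 X ->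
  map (value a) [seq rcons s l | s <- L] = iota (a l) X.
Proof.
move=> LX; rewrite -map_comp (@eq_map _ _ _ (addn (a l) \o value a)).
  by rewrite map_comp LX -iotaDl addn0.
by move=> s /=; exact: value_rcons.
Qed.

Lemma kentucky2_pos (a : nat -> nat) (N : nat) : kentucky2 a -> 0 < a N.+1.
Proof. by move=> [a1 H]; case: N => [|N]; [rewrite a1 | have [] := H N.+1]. Qed.

(** Each block appended in [legals] is an initial interval translated by the new term. By
    [kentucky2_next] that term equals the length reached so far, so the blocks fit end to end. *)
Lemma legalsP (a : nat -> nat) (ka : kentucky2 a) (n : nat) :
  enumerates (legals n) n.*2 /\ map (value a) (legals n) = iota 0 (a n.*2.+1).
Proof.
elim/ltn_ind: n => -[|m] IH.
  split; first exact: enumerates_nil.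
  by have [-> _] := ka; rewrite /= /value big_nil.
have [Em Vm] := IH m (ltnSn m).
have [Ep Vp] : enumerates (legals m.-1) m.-1.*2 /\
    map (value a) (legals m.-1) = iota 0 (a m.-1.*2.+1) by apply: IH; lia.
have E1 : enumerates (legals m ++ [seq rcons s m.*2.+1 | s <- legals m.-1]) m.*2.+1.
  by apply: enumerates_step Em Ep => i; rewrite /bin; lia.
have V1 : map (value a) (legals m ++ [seq rcons s m.*2.+1 | s <- legals m.-1]) =
    iota 0 (a m.*2.+1 + a m.-1.*2.+1).
  by rewrite map_cat Vm (value_map_rcons _ _ _ _ Vp) iotaD add0n.
have p1 := kentucky2_pos _ m.*2 ka.
(* The list with only the first index of the new bin already fixes the term at its second index,
   which is the offset of the last block. *)
have a1 : a m.*2.+2 = a m.*2.+1 + a m.-1.*2.+1.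
  by apply: kentucky2_next V1 _ => //; rewrite addn_gt0 p1.
have E2 : enumerates (legals m.+1) m.+1.*2.
  rewrite doubleS; apply: enumerates_step E1 Ep => i; rewrite /bin; lia.
have V2 : map (value a) (legals m.+1) = iota 0 (a m.*2.+2 + a m.-1.*2.+1).
  by rewrite /= map_cat V1 -a1 (value_map_rcons _ _ _ _ Vp) iotaD add0n.
split => //; rewrite V2; congr iota; rewrite doubleS.
apply/esym; apply: kentucky2_next V2 _ => //.
by rewrite addn_gt0 a1 addn_gt0 p1.
Qed.

(** Uniqueness: any two decompositions of one integer lie in a common [legals N], whose values form
    an [iota] and therefore never repeat. *)
Lemma the_decompositionE (a : nat -> nat) (ka : kentucky2 a) (n : nat) (s : seq nat) :
  s \in legals n -> the_decomposition a (value a s) = s.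
Proof.
move=> sn; rewrite /the_decomposition.
have ls : legal_decomposition a (value a s) s.
  by split => //; move: sn; rewrite (legalsP _ ka n).1 => /andP[].
case: xgetP => [t _ [lt tv]|/(_ s)] //.
have inl u N : legal u -> \max_(i <- u) i <= N -> u \in legals N.
  move=> lu uN; rewrite (legalsP _ ka N).1 lu; apply/allP => i iu /=.
  by rewrite (leq_trans (@leq_bigmax_seq _ u xpredT id i iu isT))//= (leq_trans uN)//; lia.
pose N := \max_(i <- s) i + \max_(i <- t) i.
have sN : s \in legals N by apply: inl; [case: ls | exact: leq_addr].
have tN : t \in legals N by apply: inl => //; exact: leq_addl.
have uV : uniq (map (value a) (legals N)) by rewrite (legalsP _ ka N).2 iota_uniq.
have := @nth_uniq _ 0 _ (index t (legals N)) (index s (legals N)) _ _ uV.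
rewrite size_map !index_mem => /(_ tN sN).
rewrite !(nth_map [::]) ?index_mem// !nth_index// -[value a t]tv eqxx => /esym/eqP its.
by rewrite -(nth_index [::] tN) its nth_index.
Qed.

Lemma sum_decompositions (V : nmodType) (a : nat -> nat) (ka : kentucky2 a)
    (f : seq nat -> V) (n : nat) :
  (\sum_(m < a (2 * n + 1)%N) f (the_decomposition a m) = \sum_(s <- legals n) f s)%R.
Proof.
rewrite -(big_mkord xpredT (fun m => f (the_decomposition a m))) mul2n addn1.
rewrite /index_iota subn0 -(legalsP _ ka n).2 big_map.
by apply: eq_big_seq => s /the_decompositionE ->.
Qed.

Lemma sum_legals_rec (V : nmodType) (f : nat -> V) (n : nat) :
  (\sum_(s <- legals n.+2) f (size s) = \sum_(s <- legals n.+1) f (size s) +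
    (\sum_(s <- legals n) f (size s).+1) *+ 2)%R.
Proof.
rewrite [legals n.+2]/= -/(legals n.+1) !big_cat /= !big_map mulr2n addrA.
by congr (_ + _ + _)%R; apply: eq_bigr => s _; rewrite size_rcons.
Qed.

Definition count_legals (n k : nat) : nat := count (fun s => size s == k) (legals n).

(** The recurrence inherited from [sum_legals_rec] is Pascal's rule with a factor 2 per summand.
    Large [k] is treated apart because of truncated subtraction; there every binomial vanishes. *)
Lemma count_legalsE (n k : nat) : count_legals n k = 2 ^ k * 'C(n.+1 - k, k).
Proof.
have cE m i : count_legals m i = \sum_(s <- legals m) (if size s == i then 1 else 0).
  by rewrite -big_mkcond sum1_count.
have cS m i : count_legals m.+2 i.+1 = count_legals m.+1 i.+1 + (count_legals m i) * 2.
  rewrite !cE (sum_legals_rec _ (fun j => if j == i.+1 then 1 else 0)) mulr2n muln2.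
  by rewrite -[X in _ + X]addnn.
have c0 m : count_legals m 0 = 1.
  elim/ltn_ind: m => -[|[|m]] IH //.
  rewrite -[RHS](IH m.+1)// !cE (sum_legals_rec _ (fun j => if j == 0 then 1 else 0)).
  by rewrite [X in (_ + X *+ _)%R]big1 // mul0rn addr0.
elim/ltn_ind: n k => -[|[|n]] IH [|k]; rewrite ?c0 ?bin0 ?expn0//.
- by rewrite subSS sub0n bin0n muln0.
- by case: k => [//|k]; rewrite !subSS sub0n bin0n muln0.
rewrite cS !IH//; have [kn|kn] := leqP k n.+1.
  rewrite !subSS expnS (_ : n.+2 - k = (n.+1 - k).+1); last lia.
  by rewrite binS; lia.
by rewrite !bin_small//; lia.
Qed.

(** Both counts are compared with the intermediate coefficient ['C(n - k, k)], once by changing the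
    lower index and once the upper one. *)
Lemma count_legals_ratio (n k : nat) : k.*2 <= n ->
  count_legals n k.+1 * (k.+1 * (n.+1 - k)) =
  count_legals n k * (2 * (n.+1 - k.*2) * (n - k.*2)).
Proof.
move=> kn; rewrite !count_legalsE subSS expnS.
have h1 := mul_bin_left (n - k) k.
have h2 := mul_bin_down (n.+1 - k) k.
have e1 : (n.+1 - k).-1 = n - k by lia.
have e2 : n - k - k = n - k.*2 by lia.
have e3 : n.+1 - k - k = n.+1 - k.*2 by lia.
move: h1 h2; rewrite e1 e2 e3.
move: 'C(n - k, k.+1) 'C(n - k, k) 'C(n.+1 - k, k) => x y z.
move: (2 ^ k) (n.+1 - k) (n - k.*2) (n.+1 - k.*2) k.+1 => p A B C K h1 h2.
transitivity (2 * p * (K * x) * A); first lia.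
by rewrite h1; transitivity (2 * p * B * (A * y)); [lia | rewrite h2; lia].
Qed.

End Decompositions.

(** * Closed forms of the first two moments and their asymptotics *)

Section Moments.
Variable R : realType.

(** The [j]-th moment before normalisation; the case [j = 0] is the number of integers below
    [a (2 * n + 1)]. *)
Definition power_sum (j n : nat) : R := \sum_(s <- legals n) (size s)%:R ^+ j.

Lemma power_sum0_rec (n : nat) :
  power_sum 0 n.+2 = power_sum 0 n.+1 + 2 * power_sum 0 n.
Proof.
by rewrite /power_sum (sum_legals_rec _ (fun k => k%:R ^+ 0)) mulr_natl.
Qed.

Lemma power_sum1_rec (n : nat) :
  power_sum 1 n.+2 = power_sum 1 n.+1 + 2 * (power_sum 1 n + power_sum 0 n).
Proof.
rewrite /power_sum (sum_legals_rec _ (fun k => k%:R ^+ 1)) mulr_natl -big_split.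
by congr (_ + _ *+ 2); apply: eq_bigr => s _; rewrite /= expr0 !expr1 -natr1.
Qed.

Lemma power_sum2_rec (n : nat) :
  power_sum 2 n.+2 =
  power_sum 2 n.+1 + 2 * (power_sum 2 n + 2 * power_sum 1 n + power_sum 0 n).
Proof.
rewrite /power_sum (sum_legals_rec _ (fun k => k%:R ^+ 2)) mulr_natl.
rewrite mulr_sumr -!big_split.
by congr (_ + _ *+ 2); apply: eq_bigr => s _; rewrite /= -natr1; ring.
Qed.

(** The characteristic roots of [x ^ 2 = x + 2] are 2 and -1. In the next two moments the lower ones
    act as forcing terms, which makes the coefficients polynomials of degree [j] in [n]. *)
Lemma power_sum0E (n : nat) : power_sum 0 n = (4 * 2 ^+ n - (-1) ^+ n) / 3.
Proof.
elim/ltn_ind: n => -[|[|n]] IH.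
- by rewrite /power_sum big_seq1 /=; field.
- by rewrite /power_sum !big_cons big_nil /=; field.
by rewrite power_sum0_rec !IH// !exprS; field.
Qed.

Lemma power_sum1E (n : nat) :
  power_sum 1 n = ((12 * n%:R + 8) * 2 ^+ n - (6 * n%:R + 8) * (-1) ^+ n) / 27.
Proof.
elim/ltn_ind: n => -[|[|n]] IH.
- by rewrite /power_sum big_seq1 /=; field.
- by rewrite /power_sum !big_cons big_nil /=; field.
by rewrite power_sum1_rec power_sum0E !IH// !exprS -!natr1; field.
Qed.

Lemma power_sum2E (n : nat) :
  power_sum 2 n = ((12 * n%:R ^+ 2 + 24 * n%:R + 16) * 2 ^+ n -
                   (12 * n%:R ^+ 2 + 30 * n%:R + 16) * (-1) ^+ n) / 81.
Proof.
elim/ltn_ind: n => -[|[|n]] IH.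
- by rewrite /power_sum big_seq1 /=; field.
- by rewrite /power_sum !big_cons big_nil /=; field.
by rewrite power_sum2_rec power_sum1E power_sum0E !IH// !exprS -!natr1; field.
Qed.

Lemma pow2_ge1 (n : nat) : 1 <= 2 ^+ n :> R.
Proof. by rewrite -natrX ler1n expn_gt0. Qed.

Lemma sign_cases (n : nat) : (-1) ^+ n = 1 :> R \/ (-1) ^+ n = -1 :> R.
Proof. by rewrite -signr_odd; case: (odd n); [right; rewrite expr1 | left]. Qed.

Lemma power_sum0_ge (n : nat) : 2 ^+ n <= power_sum 0 n.
Proof.
by rewrite power_sum0E; have := pow2_ge1 n; case: (sign_cases n) => -> ?; lra.
Qed.

Lemma power_sum0_gt0 (n : nat) : 0 < power_sum 0 n.
Proof. by have := power_sum0_ge n; have := pow2_ge1 n; lra. Qed.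

Definition avg (n : nat) : R := power_sum 1 n / power_sum 0 n.
Definition variation (n : nat) : R := power_sum 2 n / power_sum 0 n - avg n ^+ 2.

(** The main terms in [2 ^+ n] cancel exactly, leaving an explicit multiple of [(-1) ^+ n] over
    [power_sum 0 n]. *)
Lemma avg_asymptotics (n : nat) : (0 < n)%N ->
  `|avg n - (n%:R / 3 + 2 / 9)| <= n%:R / 2 ^+ n.
Proof.
move=> n0; have n1 : 1 <= n%:R :> R by rewrite ler1n.
have Z0 := power_sum0_gt0 n; have ZX := power_sum0_ge n; have X1 := pow2_ge1 n.
have -> : avg n - (n%:R / 3 + 2 / 9) =
    - (-1) ^+ n * ((n%:R + 2) / 9 / power_sum 0 n).
  rewrite /avg; apply: (@mulIf _ (power_sum 0 n)); first by rewrite gt_eqF.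
  rewrite mulrBl -!mulrA mulVf ?gt_eqF// !mulr1 power_sum1E power_sum0E.
  by field.
rewrite normrM normrN normrX normrN1 expr1n mul1r ger0_norm; last first.
  by rewrite divr_ge0// ?ltW//; lra.
rewrite ler_pdivrMr// mulrAC ler_pdivlMr; last lra.
have := ler_wpM2l (ler0n R n) ZX; nra.
Qed.

(** Over the denominator [power_sum 0 n ^+ 2] all terms in [4 ^+ n] cancel; [- B / 729] is the
    numerator that remains. *)
Lemma variation_asymptotics (n : nat) : (0 < n)%N ->
  `|variation n - (2 * n%:R / 27 + 8 / 81)| <= n%:R ^+ 2 / 2 ^+ n.
Proof.
move=> n0; have n1 : 1 <= n%:R :> R by rewrite ler1n.
have Z0 := power_sum0_gt0 n; have ZX := power_sum0_ge n; have X1 := pow2_ge1 n.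
have e2 : (-1) ^+ n * (-1) ^+ n = 1 :> R by rewrite -expr2 sqrr_sign.
pose B : R := (-1) ^+ n * 2 ^+ n * (36 * n%:R ^+ 2 + 96 * n%:R + 48) + (12 * n%:R + 24).
have -> : variation n - (2 * n%:R / 27 + 8 / 81) = - B / 729 / power_sum 0 n ^+ 2 :> R.
  rewrite /variation /avg; apply: (@mulIf _ (power_sum 0 n ^+ 2)).
    by rewrite expf_neq0// gt_eqF.
  rewrite [RHS]divfK ?expf_neq0 ?gt_eqF//.
  transitivity (power_sum 2 n * power_sum 0 n - power_sum 1 n ^+ 2 -
     (2 * n%:R / 27 + 8 / 81) * power_sum 0 n ^+ 2).
    by field; rewrite gt_eqF.
  rewrite power_sum2E power_sum1E power_sum0E /B.
  move: ((-1) ^+ n) (2 ^+ n) (n%:R) e2 => e X m e2.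
  by field: e2.
have BX : `|B| <= 2 ^+ n * (216 * n%:R ^+ 2).
  rewrite /B (le_trans (ler_normD _ _))// !normrM normrX normrN1 expr1n mul1r.
  rewrite !ger0_norm; [|nra|nra|lra].
  (* 216 is the sum of all the coefficients, since [n] is at least 1; it is below 729. *)
  have q : 36 * n%:R ^+ 2 + 96 * n%:R + 48 + (12 * n%:R + 24) <= 216 * n%:R ^+ 2 :> R.
    by nra.
  have X0 : 0 <= 2 ^+ n :> R by lra.
  have := ler_wpM2l X0 q; have : 12 * n%:R + 24 <= 2 ^+ n * (12 * n%:R + 24) :> R by nra.
  lra.
have c0 : 0 <= 729^-1 :> R by rewrite invr_ge0 ler0n.
rewrite normrM normfV normrX (ger0_norm (ltW Z0)) ler_pdivrMr; last exact: exprn_gt0.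
apply: (@le_trans _ _ (n%:R ^+ 2 * 2 ^+ n)).
  by rewrite normrM normrN (ger0_norm c0); have := sqr_ge0 (n%:R : R); nra.
have : 2 ^+ n * 2 ^+ n <= power_sum 0 n ^+ 2 by nra.
rewrite [X in _ -> _ <= X]mulrAC ler_pdivlMr; last lra.
by rewrite -mulrA => h; rewrite ler_wpM2l// sqr_ge0.
Qed.

End Moments.

(** * From the uniform probability to finite sums over index lists *)

Section Uniform.
Variable R : realType.

(** The uniform law is a scaled sum of Dirac masses; nonnegativity of [f] lets the integral split
    without integrability conditions. *)
Lemma expectation_uniform_below (N : nat) (f : nat -> R) :
  (0 < N)%N -> (forall k, 0 <= f k) ->
  ('E_(uniform_below R N)[f])%E = ((\sum_(k < N) f k) / N%:R)%:E.
Proof.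
move=> N0 f0; rewrite unlock.
have N1 : 0 <= N%:R^-1 :> R by rewrite invr_ge0.
pose m : {measure set nat -> \bar R} := mscale (NngNum N1) (msum (fun k : nat => \d_k) N).
rewrite (eq_measure_integral m).
  rewrite ge0_integral_mscale//; last by move=> x _; rewrite lee_fin.
  rewrite ge0_integral_measure_sum//; last by move=> x _; rewrite lee_fin.
  rewrite mulrC EFinM -sumEFin; congr (_ * _)%E; apply: eq_bigr => k _.
  by rewrite integral_dirac// diracT mul1e.
move=> A _ _; apply: etrans (uniform_belowE _ _ N0) _.
rewrite /m /mscale/= /msum mulrC EFinM -sumEFin.
by congr (_ * _)%E; apply: eq_bigr => k _; rewrite diracE.
Qed.

Variables (a : nat -> nat) (ka : kentucky2 a).

Lemma kentucky2_power_sum0 (n : nat) : (a (2 * n + 1)%N)%:R = power_sum R 0 n.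
Proof.
rewrite -[LHS]mulr1 mulr_natl -[X in _ *+ X]card_ord -sumr_const.
exact: (sum_decompositions _ _ ka (fun s => (size s)%:R ^+ 0)).
Qed.

Let a_gt0 (n : nat) : (0 < a (2 * n + 1))%N.
Proof. by rewrite addn1; exact: kentucky2_pos. Qed.

Lemma mean_num_summands (n : nat) :
  mean (uniform_below R (a (2 * n + 1)%N)) (num_summands R a) = avg R n.
Proof.
rewrite /mean expectation_uniform_below//= kentucky2_power_sum0.
by rewrite (sum_decompositions _ _ ka (fun s => (size s)%:R)).
Qed.

Lemma var_num_summands (n : nat) :
  var (uniform_below R (a (2 * n + 1)%N)) (num_summands R a) = variation R n.
Proof.
rewrite /var /variance unlock.
rewrite -/(mean (uniform_below R (a (2 * n + 1)%N)) (num_summands R a)).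
rewrite mean_num_summands expectation_uniform_below//=; last first.
  by move=> k; rewrite -expr2 sqr_ge0.
rewrite kentucky2_power_sum0.
rewrite (sum_decompositions _ _ ka
  (fun s => ((size s)%:R - avg R n) * ((size s)%:R - avg R n))).
have Z0 := power_sum0_gt0 R n.
have -> : \sum_(s <- legals n) ((size s)%:R - avg R n) * ((size s)%:R - avg R n) =
    power_sum R 2 n - 2 * avg R n * power_sum R 1 n + avg R n ^+ 2 * power_sum R 0 n.
  rewrite /power_sum !mulr_sumr -sumrB -big_split.
  by apply: eq_bigr => s _ /=; ring.
by rewrite /variation /avg; field; rewrite gt_eqF.
Qed.

Lemma cdf_standardized (n : nat) (x : R) :
  let P := uniform_below R (a (2 * n + 1)%N) in
  cdf (standardized P (num_summands R a) : {RV P >-> R}) x =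
  ((\sum_(s <- legals n)
      (((size s)%:R - avg R n) / Num.sqrt (variation R n) <= x)%R%:R) /
    power_sum R 0 n)%:E.
Proof.
move=> P; rewrite /cdf /distribution /pushforward.
apply: etrans (uniform_belowE _ _ (a_gt0 n)) _.
rewrite kentucky2_power_sum0 -(sum_decompositions _ _ ka (fun s => 
   ((((size s)%:R - avg R n) / Num.sqrt (variation R n) <= x)%R)%:R)).
congr (_ / _)%:E; apply: eq_bigr => k _; congr (_%:R); congr nat_of_bool.
apply/idP/idP => [/set_mem|H]; last apply: mem_set;
  by rewrite /= in_itv /= /standardized mean_num_summands var_num_summands.
Qed.

End Uniform.

(** * Comparison of consecutive counts with Gaussian weights *)

Section LocalRatio.
Variable R : realType.
Implicit Types (T u t : R) (n k l : nat).

(** The leading-order standard deviation. With it and the centre [n / 3], Gaussian increments have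
    rational exponents; the exact moments return in [near_cdf_sandwich]. *)
Definition scale n : R := Num.sqrt (2 * n%:R / 27).
Definition zscore n k : R := (k%:R - n%:R / 3) / scale n.
Definition gauss t : R := expR (- t ^+ 2 / 2).

(** Apply [1 + y <= expR y] at [y = - (u - 2 * u ^+ 2)], together with [(1 + u) * (1 - u + 2 * u ^+
    2) = 1 + u ^+ 2 * (1 + 2 * u) >= 1]. *)
Lemma expR_lower_1D u : `|u| <= 1 / 2 -> expR (u - 2 * u ^+ 2) <= 1 + u.
Proof.
rewrite ler_norml => /andP[u1 u2].
have v1 : 0 < 1 - u + 2 * u ^+ 2 by nra.
have := expR_ge1Dx (- (u - 2 * u ^+ 2)); rewrite expRN => h.
have e0 := expR_gt0 (u - 2 * u ^+ 2).
have h' : (1 - u + 2 * u ^+ 2) * expR (u - 2 * u ^+ 2) <= 1.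
  by rewrite -ler_pdivlMr// mul1r (le_trans _ h)//; lra.
rewrite -(ler_pM2l v1) (le_trans h')//; nra.
Qed.

Lemma scale_ge0 n : 0 <= scale n. Proof. exact: sqrtr_ge0. Qed.

Lemma sqr_scale n : scale n ^+ 2 = 2 * n%:R / 27.
Proof. by rewrite sqr_sqrtr// divr_ge0// mulr_ge0. Qed.

Lemma scale_gt0 n : (0 < n)%N -> 0 < scale n.
Proof. by move=> n0; rewrite sqrtr_gt0 divr_gt0// mulr_gt0// ltr0n. Qed.

Lemma scale_bounds n : Num.sqrt n%:R / 4 <= scale n <= Num.sqrt n%:R.
Proof.
have n0 : 0 <= n%:R :> R by [].
apply/andP; split; rewrite -ler_sqr ?nnegrE ?divr_ge0 ?sqrtr_ge0// ?expr_div_n;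
  rewrite sqr_sqrtr// ?sqr_sqrtr ?divr_ge0 ?mulr_ge0//; lra.
Qed.

Lemma zscoreS n k : zscore n k.+1 = zscore n k + (scale n)^-1.
Proof. by rewrite /zscore -natr1; ring. Qed.

Lemma zscoreK n k : (0 < n)%N -> zscore n k * scale n = k%:R - n%:R / 3.
Proof. by move=> n0; rewrite divfK// gt_eqF// scale_gt0. Qed.

Lemma gauss_gt0 t : 0 < gauss t. Proof. exact: expR_gt0. Qed.

Lemma gauss_zscoreS n k : (0 < n)%N ->
  gauss (zscore n k.+1) =
  gauss (zscore n k) * expR (- (27 / 4 * (2 * (k%:R - n%:R / 3) + 1) / n%:R)).
Proof.
move=> n0; have n1 : n%:R != 0 :> R by rewrite pnatr_eq0 -lt0n.
rewrite /gauss -expRD /zscore !expr_div_n sqr_scale -natr1; congr expR.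
by field.
Qed.

(** A local limit law amounts to this quotient being nearly constant in [k] over the window. *)
Definition ratio n k : R := (count_legals n k)%:R / gauss (zscore n k).

Lemma ratio_ge0 n k : 0 <= ratio n k.
Proof. by rewrite divr_ge0// ltW// gauss_gt0. Qed.

(* The four factors of [count_legals_ratio], divided by their values n/3 or 2n/3 at
   the centre, are [1 + u] with [`|u| <= 9 * T / sqrt n]; their first-order parts
   reproduce the Gaussian increment up to 21 / (4 n). *)
Lemma ratio_step n k T : 1 <= T -> 18 * T <= Num.sqrt n%:R ->
  `|zscore n k| <= T ->
  ratio n k.+1 <= expR (330 * T ^+ 2 / n%:R) * ratio n k /\
  ratio n k <= expR (330 * T ^+ 2 / n%:R) * ratio n k.+1.
Proof.
move=> T1; set r := Num.sqrt n%:R => Tr kT.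
have r0 : 0 < r by lra.
have rn : r ^+ 2 = n%:R by rewrite sqr_sqrtr.
have n0 : (0 < n)%N by rewrite -(ltr0n R) -rn exprn_gt0.
have nR : 0 < n%:R :> R by rewrite ltr0n.
pose x : R := k%:R - n%:R / 3.
have xr : `|x| <= T * r.
  rewrite /x -zscoreK// normrM (ger0_norm (scale_ge0 n)).
  by rewrite ler_pM// ?scale_ge0//; case/andP: (scale_bounds n).
have /andP[x1 x2] : - (T * r) <= x <= T * r by rewrite -ler_norml.
(* Here [x <= T * r <= n / 18], so [k] stays below [n / 3 + n / 18 < n / 2]. *)
have k2 : (k.*2 <= n)%N.
  by rewrite -(ler_nat R) -mul2n natrM; move: x2; rewrite /x; nra.
have k2' : (k <= n.+1)%N by lia.
pose v : R := n%:R^-1; have v0 : 0 < v by rewrite invr_gt0.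
have nv : n%:R * v = 1 by rewrite divff// gt_eqF.
pose u1 := (3 - 6 * x) * v; pose u2 := - 6 * x * v.
pose u3 := (3 * x + 3) * v; pose u4 := 3 / 2 * (1 - x) * v.
have ub (y : R) : `|y| <= 9 * T * r -> `|y * v| <= 1 / 2 /\ (y * v) ^+ 2 <= 81 * T ^+ 2 * v.
  move=> yT; rewrite -real_normK ?num_real// normrM (gtr0_norm v0).
  have yv : `|y| * v <= 9 * T * r * v by rewrite ler_wpM2r// ltW.
  have rv : r * v * r = 1 by rewrite mulrAC -expr2 rn.
  have rv0 : 0 < r * v by rewrite mulr_gt0.
  have Trv : 18 * T * (r * v) <= r * (r * v) by rewrite ler_wpM2r// ltW.
  split; first by lra.
  rewrite (_ : 81 * T ^+ 2 * v = (9 * T * r * v) ^+ 2); last first.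
    by transitivity (81 * T ^+ 2 * v * (r * v * r)); [rewrite rv mulr1 | ring].
  by rewrite ler_sqr ?nnegrE ?mulr_ge0//; lra.
have [u1s u1q] : `|u1| <= 1 / 2 /\ u1 ^+ 2 <= 81 * T ^+ 2 * v.
  by apply: ub; rewrite ler_norml; apply/andP; split; nra.
have [u2s u2q] : `|u2| <= 1 / 2 /\ u2 ^+ 2 <= 81 * T ^+ 2 * v.
  by apply: ub; rewrite ler_norml; apply/andP; split; nra.
have [u3s u3q] : `|u3| <= 1 / 2 /\ u3 ^+ 2 <= 81 * T ^+ 2 * v.
  by apply: ub; rewrite ler_norml; apply/andP; split; nra.
have [u4s u4q] : `|u4| <= 1 / 2 /\ u4 ^+ 2 <= 81 * T ^+ 2 * v.
  by apply: ub; rewrite ler_norml; apply/andP; split; nra.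
set p := (count_legals n k)%:R : R; set p' := (count_legals n k.+1)%:R : R.
have p0 : 0 <= p by []. have p0' : 0 <= p' by [].
have key : p' * ((1 + u3) * (1 + u4)) = p * ((1 + u1) * (1 + u2)).
  have := congr1 (fun m => m%:R : R) (count_legals_ratio n k k2).
  rewrite !natrM !natrB// ?(leq_trans k2)// -/p -/p' -mul2n natrM -!natr1 => E.
  have -> : 1 + u3 = (k%:R + 1) * (3 * v) by rewrite /u3 /x; nra.
  have -> : 1 + u4 = (n%:R + 1 - k%:R) * (3 / 2 * v) by rewrite /u4 /x; nra.
  have -> : 1 + u1 = (n%:R + 1 - 2 * k%:R) * (3 * v) by rewrite /u1 /x; nra.
  have -> : 1 + u2 = (n%:R - 2 * k%:R) * (3 * v) by rewrite /u2 /x; nra.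
  transitivity ((p' * ((k%:R + 1) * (n%:R + 1 - k%:R))) * (9 / 2 * v ^+ 2)); first by field.
  by rewrite E; field.
have prod_le (y z : R) : `|y| <= 1 / 2 -> `|z| <= 1 / 2 ->
    expR (y - 2 * y ^+ 2 + (z - 2 * z ^+ 2)) <= (1 + y) * (1 + z) <= expR (y + z).
  move=> hy hz; have := hy; have := hz; rewrite !ler_norml => /andP[z1 z2] /andP[y1 y2].
  rewrite (expRD (y - 2 * y ^+ 2)) (expRD y z); apply/andP.
  split; apply: ler_pM; rewrite ?expR_ge0 ?expR_lower_1D//.
  - lra.
  - lra.
  - exact: expR_ge1Dx.
  - exact: expR_ge1Dx.
have /andP[a1 a2] := prod_le _ _ u1s u2s.
have /andP[b1 b2] := prod_le _ _ u3s u4s.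
set L := 27 / 4 * (2 * x + 1) * v.
have qS : ratio n k.+1 = p' * expR L / gauss (zscore n k).
  rewrite /ratio gauss_zscoreS// -/x -/v -/L expRN -/p'.
  by rewrite invfM invrK mulrA [LHS]mulrAC.
have g0 := gauss_gt0 (zscore n k).
rewrite qS /ratio -/p -/v; split; rewrite mulrA ler_pM2r ?invr_gt0//.
- have h : p' * expR (u3 - 2 * u3 ^+ 2 + (u4 - 2 * u4 ^+ 2)) <= p * expR (u1 + u2).
    by rewrite (le_trans (ler_wpM2l p0' b1))// key ler_wpM2l.
  have e0 := expR_gt0 (u3 - 2 * u3 ^+ 2 + (u4 - 2 * u4 ^+ 2)).
  rewrite -(ler_pM2r e0) mulrAC (le_trans (ler_wpM2r (expR_ge0 _) h))//.
  rewrite -[leLHS]mulrA -expRD [X in _ <= X * _]mulrC -[leRHS]mulrA -expRD.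
  rewrite ler_wpM2l// ler_expR.
  (* The linear terms in [x] cancel and leave [21 / 4 * v]. The squares cost at most
     [4 * 81 * T ^+ 2 * v], and [324 + 21 / 4 <= 330]. *)
  rewrite /L /u1 /u2; move: u3q u4q; rewrite /u3 /u4; nra.
- have h : p * expR (u1 - 2 * u1 ^+ 2 + (u2 - 2 * u2 ^+ 2)) <= p' * expR (u3 + u4).
    by rewrite (le_trans (ler_wpM2l p0 a1))// -key ler_wpM2l.
  have e0 := expR_gt0 (u1 - 2 * u1 ^+ 2 + (u2 - 2 * u2 ^+ 2)).
  rewrite -(ler_pM2r e0) (le_trans h)//.
  rewrite [X in _ <= X * _]mulrCA -[leRHS]mulrA -!expRD ler_wpM2l// ler_expR.
  rewrite /L /u3 /u4; move: u1q u2q; rewrite /u1 /u2; nra.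
Qed.

End LocalRatio.

Arguments gauss {R} t.

(** * Near-constancy of the quotient over a window, and increments of the normal distribution
    function *)

Section Window.
Variable R : realType.
Implicit Types (T t h : R) (n k l : nat).
Local Notation zscore := (zscore R).
Local Notation scale := (scale R).
Local Notation ratio := (ratio R).

Lemma ratio_iter n k d T : 1 <= T -> 18 * T <= Num.sqrt n%:R ->
  `|zscore n k| <= T -> `|zscore n (k + d)| <= T ->
  ratio n (k + d) <= expR (330 * T ^+ 2 / n%:R) ^+ d * ratio n k /\
  ratio n k <= expR (330 * T ^+ 2 / n%:R) ^+ d * ratio n (k + d).
Proof.
move=> T1 Tr kT; elim: d => [|d IH]; first by rewrite addn0 expr0 mul1r.
rewrite addnS => dT.
have dT' : `|zscore n (k + d)| <= T.
  move: dT kT; rewrite zscoreS /zscore natrD mulrDl mulrDl.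
  have s0 : 0 <= (scale n)^-1 by rewrite invr_ge0 scale_ge0.
  have ds0 : 0 <= d%:R / scale n by rewrite mulr_ge0.
  by rewrite !ler_norml => /andP[? ?] /andP[? ?]; apply/andP; split; lra.
have [h1 h2] := IH dT'.
have [g1 g2] := ratio_step _ _ _ _ T1 Tr dT'.
set e := expR _ in h1 h2 g1 g2 *; have e0 : 0 <= e by exact: expR_ge0.
rewrite exprS; split.
  by rewrite (le_trans g1)// -mulrA ler_wpM2l.
by rewrite (le_trans h2)// [e * _]mulrC -mulrA ler_wpM2l ?exprn_ge0.
Qed.

(** Two indices of the window are at most [2 * T * Num.sqrt n%:R] steps apart, and each step costs
    [330 * T ^+ 2 / n%:R] in the exponent. *)
Lemma ratio_window n k l T : 1 <= T -> 18 * T <= Num.sqrt n%:R ->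
  `|zscore n k| <= T -> `|zscore n l| <= T ->
  ratio n k <= expR (660 * T ^+ 3 / Num.sqrt n%:R) * ratio n l.
Proof.
move=> T1 Tr kT lT.
have r0 : 0 < Num.sqrt n%:R :> R by lra.
have rn : Num.sqrt n%:R ^+ 2 = n%:R :> R by rewrite sqr_sqrtr.
have n0 : (0 < n)%N by rewrite -(ltr0n R) -rn exprn_gt0.
have bound i d : `|zscore n i| <= T -> `|zscore n (i + d)| <= T ->
    expR (330 * T ^+ 2 / n%:R) ^+ d <= expR (660 * T ^+ 3 / Num.sqrt n%:R).
  move=> iT dT; rewrite -expRM_natl ler_expR.
  have dr : d%:R <= 2 * T * Num.sqrt n%:R :> R.
    have -> : d%:R = (zscore n (i + d) - zscore n i) * scale n :> R.
      by rewrite mulrBl !zscoreK// natrD; ring.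
    have /andP[_ sr] := scale_bounds R n; have s0 := scale_ge0 R n.
    move: iT dT; rewrite !ler_norml => /andP[? ?] /andP[? ?].
    rewrite (@le_trans _ _ (2 * T * scale n))// ?ler_wpM2r ?ler_wpM2l//; lra.
  have -> : 660 * T ^+ 3 / Num.sqrt n%:R = 2 * T * Num.sqrt n%:R * (330 * T ^+ 2 / n%:R).
    by move: (Num.sqrt _) r0 rn => r r0 <-; field; rewrite gt_eqF.
  apply: ler_wpM2r dr.
  exact: divr_ge0 (mulr_ge0 (ler0n _ _) (sqr_ge0 _)) (ler0n _ _).
have [kl|/ltnW lk] := leqP k l.
  have lT' : `|zscore n (k + (l - k))| <= T by rewrite subnKC.
  have [_] := ratio_iter _ _ _ _ T1 Tr kT lT'; rewrite subnKC// => h.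
  by rewrite (le_trans h)// ler_wpM2r ?ratio_ge0// (bound k).
have kT' : `|zscore n (l + (k - l))| <= T by rewrite subnKC.
have [+ _] := ratio_iter _ _ _ _ T1 Tr lT kT'; rewrite subnKC// => h.
by rewrite (le_trans h)// ler_wpM2r ?ratio_ge0// (bound l).
Qed.

Definition Phi t : R := fine (normal_prob 0 1 `]-oo, t]%classic).

Lemma normal_prob_PhiE t : normal_prob 0 1 `]-oo, t]%classic = (Phi t)%:E.
Proof. by rewrite /Phi fineK// fin_num_measure. Qed.

Lemma PhiB t t' : t <= t' ->
  (Phi t' - Phi t)%:E = normal_prob 0 1 `]t, t']%classic.
Proof.
move=> tt'; rewrite EFinB -!normal_prob_PhiE.
have -> : `]-oo, t']%classic = `]-oo, t]%classic `|` `]t, t']%classic :> set R.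
  apply/seteqP; split => x /=; rewrite !in_itv /=.
    by move=> xt'; have [xt|tx] := leP x t; [left | right].
  by case=> [xt|/andP[]//]; exact: le_trans tt'.
rewrite measureU//; last first.
  by apply/seteqP; split => x //= []; rewrite !in_itv/= => xt /andP[]; rewrite ltNge xt.
by rewrite addeAC subee ?add0e// fin_num_measure.
Qed.

Lemma Phi_ge0 t : 0 <= Phi t. Proof. exact: fine_ge0. Qed.

Lemma Phi_le1 t : Phi t <= 1.
Proof. by rewrite -lee_fin -normal_prob_PhiE probability_le1. Qed.

Lemma le_Phi t t' : t <= t' -> Phi t <= Phi t'.
Proof. by move=> tt'; rewrite -subr_ge0 -lee_fin PhiB. Qed.

(** On [[t, t + h]] the exponent [s ^+ 2 / 2] moves by at most [h * (T + h)], which bounds the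
    density on both sides by constants. *)
Lemma Phi_increment t h T : 0 <= h -> `|t| <= T ->
  normal_peak 1 * h * gauss t * expR (- (h * (T + h))) <= Phi (t + h) - Phi t <=
  normal_peak 1 * h * gauss t * expR (h * (T + h)).
Proof.
move=> h0; rewrite ler_norml => /andP[tT1 tT2].
rewrite -!lee_fin PhiB ?lerDl// /normal_prob.
have c0 : 0 <= normal_peak 1 :> R by exact: normal_peak_ge0.
have pdfE s : t <= s <= t + h ->
    normal_peak 1 * gauss t * expR (- (h * (T + h))) <= normal_pdf 0 1 s <=
    normal_peak 1 * gauss t * expR (h * (T + h)).
  move=> /andP[ts sh]; rewrite normal_pdfE ?oner_neq0// /normal_fun /gauss.
  rewrite -!mulrA -!expRD subr0 expr1n -mulr_natl mulr1.
  by apply/andP; split; rewrite ler_wpM2l// ler_expR; nra.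
have intc (c : R) : 0 <= c ->
    (\int[lebesgue_measure]_(s in `]t, (t + h)%R]) cst c%:E s = (h * c)%:E)%E.
  move=> c00; rewrite integral_cst//= lebesgue_measure_itv /= lte_fin.
  case: ltP => [_|]; first by rewrite -EFinB -EFinM mulrC addrAC subrr add0r.
  by move=> h1; rewrite (_ : h = 0) ?mule0 ?mul0r//; lra.
have nn c : 0 <= normal_peak 1 * gauss t * expR c by rewrite !mulr_ge0 ?expR_ge0.
have mpdf : measurable_fun `]t, (t + h)%R]%classic (fun s : R => (normal_pdf 0 1 s)%:E).
  by apply/measurable_EFinP; apply: measurable_funTS; exact: measurable_normal_pdf.
have assoc c : normal_peak 1 * h * gauss t * c = h * (normal_peak 1 * gauss t * c).
  by ring.
rewrite !assoc -!intc//; apply/andP; split; apply: ge0_le_integral => //.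
- by move=> s _; exact: nn.
- move=> s /=; rewrite in_itv/= lee_fin => /andP[/ltW ts sh].
  by have := pdfE s; rewrite ts sh => /(_ isT)/andP[].
- by move=> s _; rewrite lee_fin normal_pdf_ge0.
- move=> s /=; rewrite in_itv/= lee_fin => /andP[/ltW ts sh].
  by have := pdfE s; rewrite ts sh => /(_ isT)/andP[].
Qed.

End Window.

Arguments Phi {R} t.

(** * Chebyshev bound and asymptotic lower bound for the mass of an interval *)

Section LowerBound.
Variable R : realType.
Implicit Types (T t h x : R) (n k l : nat).
Local Notation zscore := (zscore R).
Local Notation scale := (scale R).
Local Notation ratio := (ratio R).
Local Notation freq n k := ((count_legals n k)%:R : R).
Local Notation cell n k := (Phi (zscore n k.+1) - Phi (zscore n k)).

Lemma inv_scale_le n : 1 <= Num.sqrt n%:R :> R ->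
  0 < (scale n)^-1 <= 4 / Num.sqrt n%:R.
Proof.
move=> r1; have /andP[h _] := scale_bounds R n.
have s0 : 0 < scale n by lra.
rewrite invr_gt0 s0 /= -(invrK 4) -invfM lef_pV2 ?posrE//; first lra.
by rewrite mulr_gt0 ?invr_gt0//; lra.
Qed.

(** Near-proportionality of counts and normal cells, cross-multiplied so that the unknown constant
    never appears. [ratio_window] costs [660 * T ^+ 3], and each of the two uses of [Phi_increment]
    costs [4 * (T + 4)]. *)
Lemma freq_cell_cross n k l T : 1 <= T -> 18 * T <= Num.sqrt n%:R ->
  `|zscore n k| <= T -> `|zscore n l| <= T ->
  freq n k * cell n l <=
  expR ((8 * (T + 4) + 660 * T ^+ 3) / Num.sqrt n%:R) * (freq n l * cell n k).
Proof.
move=> T1 Tr kT lT.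
have r1 : 1 <= Num.sqrt n%:R :> R by lra.
have /andP[h0 h4] := inv_scale_le _ r1.
have fE i : freq n i = ratio n i * gauss (zscore n i).
  by rewrite divfK// gt_eqF// gauss_gt0.
have q0 := ratio_ge0 R n; have g0 (t : R) := ltW (gauss_gt0 R t).
have qkl := ratio_window _ _ _ _ _ T1 Tr kT lT.
have /andP[ck _] := Phi_increment _ _ _ _ (ltW h0) kT.
have /andP[_ cl] := Phi_increment _ _ _ _ (ltW h0) lT.
rewrite !fE !zscoreS.
set h := (scale n)^-1 in h0 h4 ck cl *.
set r := Num.sqrt n%:R in r1 Tr h4 qkl *.
set Gk := (X in _ * (_ * X)); set Gl := (X in _ * X <= _).
rewrite -/Gk in ck; rewrite -/Gl in cl.
set c := normal_peak 1 in ck cl; have c0 : 0 <= c by exact: normal_peak_ge0.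
set d := h * (T + h) in ck cl.
set gk := gauss (zscore n k) in ck *; set gl := gauss (zscore n l) in cl *.
have ql0 := q0 l; have gl0 : 0 <= gl by exact: g0.
have ed0 := expR_ge0 d; have eT0 := expR_ge0 (660 * T ^+ 3 / r).
have ck' : c * h * gk <= expR d * Gk.
  rewrite -[leLHS]mulr1 -(expRxMexpNx_1 d) mulrCA ler_wpM2l ?expR_ge0//.
have Gk0 : 0 <= Gk by rewrite subr_ge0 le_Phi// lerDl ltW.
apply: (@le_trans _ _ (expR (660 * T ^+ 3 / r) * ratio n l * gk * (c * h * gl * expR d))).
  apply: ler_pM => //; [exact: mulr_ge0 (q0 k) (g0 _) | | exact: ler_wpM2r (g0 _) _ _ qkl].
  by rewrite subr_ge0 le_Phi// lerDl ltW.
rewrite (_ : _ * _ =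
  expR (660 * T ^+ 3 / r) * expR d * ratio n l * gl * (c * h * gk)); last ring.
apply: (@le_trans _ _ (expR (660 * T ^+ 3 / r) * expR d * ratio n l * gl * (expR d * Gk))).
  by apply: ler_wpM2l ck'; rewrite !mulr_ge0 ?invr_ge0.
rewrite (_ : _ * _ =
  expR (660 * T ^+ 3 / r) * expR d * expR d * (ratio n l * gl * Gk)); last ring.
rewrite -!expRD; apply: ler_wpM2r; first by rewrite !mulr_ge0 ?invr_ge0.
rewrite ler_expR.
have h4' : h <= 4 by rewrite (le_trans h4)// ler_pdivrMr; lra.
have dr : d <= 4 / r * (T + 4) by rewrite /d ler_pM//; lra.
rewrite (mulrDl (8 * _)); lra.
Qed.

Lemma sum_legals_by_size (f : nat -> R) n :
  \sum_(s <- legals n) f (size s) = \sum_(k < n.+2) f k * freq n k.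
Proof.
transitivity (\sum_(s <- legals n) \sum_(k < n.+2 | size s == k) f k).
  apply: eq_big_seq => s sn; have sz : (size s < n.+2)%N.
    rewrite ltnNge; apply/negP => ns.
    have : (0 < count_legals n (size s))%N.
      by rewrite -has_count; apply/hasP; exists s.
    by rewrite count_legalsE bin_small ?muln0//; lia.
  by rewrite (big_pred1 (Ordinal sz)).
rewrite (exchange_big_dep xpredT)//=; apply: eq_bigr => k _.
by rewrite big_const_seq /count_legals iter_addr_0 mulr_natr.
Qed.

Lemma sum_freq n : \sum_(k < n.+2) freq n k = power_sum R 0 n.
Proof.
rewrite /power_sum (sum_legals_by_size (fun k => k%:R ^+ 0)).
by apply: eq_bigr => k _; rewrite expr0 mul1r.
Qed.

Lemma natr_le_exp2 n : n%:R <= 2 ^+ n :> R.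
Proof. by rewrite -natrX ler_nat ltnW// ltn_expl. Qed.

(** The second moment about [n / 3] is the variance plus the squared bias. Only its linear order in
    [n] matters; 41 is a generous constant. *)
Lemma second_moment_le n : (0 < n)%N ->
  \sum_(k < n.+2) (k%:R - n%:R / 3) ^+ 2 * freq n k <= 41 * scale n ^+ 2 * power_sum R 0 n.
Proof.
move=> n0; rewrite -(sum_legals_by_size (fun k => (k%:R - n%:R / 3) ^+ 2)).
have Z0 := power_sum0_gt0 R n.
have -> : \sum_(s <- legals n) ((size s)%:R - n%:R / 3) ^+ 2 =
    (variation R n + (avg R n - n%:R / 3) ^+ 2) * power_sum R 0 n.
  transitivity (power_sum R 2 n - 2 * (n%:R / 3) * power_sum R 1 n +
                (n%:R / 3) ^+ 2 * power_sum R 0 n).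
    rewrite /power_sum !mulr_sumr -sumrB -big_split.
    by apply: eq_bigr => s _ /=; ring.
  by rewrite /variation /avg; field; rewrite gt_eqF.
rewrite ler_pM2r// sqr_scale.
have n1 : 1 <= n%:R :> R by rewrite ler1n.
have X1 := pow2_ge1 R n; have nX := natr_le_exp2 n.
have nX1 : n%:R / 2 ^+ n <= 1 :> R by rewrite ler_pdivrMr; lra.
have := avg_asymptotics R _ n0; have := variation_asymptotics R _ n0.
rewrite expr2 -[n%:R * n%:R / _]mulrA.
have h2 : n%:R * (n%:R / 2 ^+ n) <= n%:R :> R by rewrite ler_piMr.
rewrite !ler_norml => /andP[_ v2] /andP[m1 m2].
nra.
Qed.

Lemma window_mass n T : (0 < n)%N -> 0 < T ->
  (1 - 41 / T ^+ 2) * power_sum R 0 n <= \sum_(k < n.+2 | `|zscore n k| <= T) freq n k.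
Proof.
move=> n0 T0.
have s0 := scale_gt0 R _ n0.
have h : \sum_(k < n.+2 | ~~ (`|zscore n k| <= T)) freq n k <= 41 / T ^+ 2 * power_sum R 0 n.
  have Ts : 0 < T ^+ 2 * scale n ^+ 2 by rewrite mulr_gt0 ?exprn_gt0.
  rewrite -(ler_pM2l Ts).
  rewrite (_ : _ * (_ / _ * _) = 41 * scale n ^+ 2 * power_sum R 0 n); last first.
    by field; rewrite gt_eqF.
  rewrite (le_trans _ (second_moment_le _ n0))// mulr_sumr big_mkcond /=.
  apply: ler_sum => k _; rewrite -ltNge; case: ltP => kT; last first.
    by rewrite mulr_ge0// sqr_ge0.
  rewrite ler_wpM2r// -zscoreK// exprMn ler_wpM2r ?sqr_ge0//.
  by rewrite -[leRHS]real_normK ?num_real// ler_sqr ?nnegrE ?normr_ge0// ltW.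
rewrite mulrBl mul1r lerBlDr -[leLHS]sum_freq.
by rewrite (bigID (fun k : 'I_n.+2 => `|zscore n k| <= T))/= lerD2l.
Qed.

Lemma sum_cell_le1 n (W : pred 'I_n.+2) : \sum_(k < n.+2 | W k) cell n k <= 1.
Proof.
have mono k : 0 <= cell n k.
  by rewrite subr_ge0 le_Phi// zscoreS lerDl invr_ge0 scale_ge0.
apply: (@le_trans _ _ (\sum_(k < n.+2) cell n k)).
  by rewrite big_mkcond; apply: ler_sum => k _; case: ifP.
rewrite -(big_mkord xpredT (fun k => cell n k)) telescope_sumr//.
by have := Phi_ge0 R (zscore n 0); have := Phi_le1 R (zscore n n.+2); lra.
Qed.

Lemma sum_cell_ge n (x y : R) : x <= y -> zscore n 0 <= x -> y <= zscore n n.+2 ->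
  Phi y - Phi x <= \sum_(k < n.+2 | (x <= zscore n k.+1) && (zscore n k < y)) cell n k.
Proof.
move=> xy zx yz.
(* The increments of the clamped [Phi] vanish off the selected cells. *)
pose psi t := Phi (Num.max x (Num.min t y)).
have -> : Phi y - Phi x = \sum_(k < n.+2) (psi (zscore n k.+1) - psi (zscore n k)).
  rewrite -(big_mkord xpredT (fun k => psi (zscore n k.+1) - psi (zscore n k))).
  rewrite telescope_sumr// /psi (min_idPr yz) (max_idPr xy).
  by rewrite (max_idPl _)// ge_min zx.
rewrite [leRHS]big_mkcond; apply: ler_sum => k _; rewrite /psi.
have zz : zscore n k <= zscore n k.+1 by rewrite zscoreS lerDl invr_ge0 scale_ge0.
move: (zscore n k) (zscore n k.+1) zz => s t st.
have [xt|tx] := leP x t; have [sy|ys] := ltP s y; rewrite /=.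
- have [ty|yt] := leP t y.
    rewrite (max_idPr xt); have [xs|sx] := leP x s; first by [].
    by rewrite lerB// le_Phi// ltW.
  rewrite (max_idPr xy); have [xs|sx] := leP x s.
    by rewrite lerB// le_Phi// ltW.
  by rewrite lerB// le_Phi// ltW.
- by rewrite (min_idPr (le_trans ys st)) subrr.
- have -> : Num.max x (Num.min t y) = x by apply/max_idPl; rewrite ge_min (ltW tx).
  have -> : Num.max x s = x by apply/max_idPl; exact: le_trans st (ltW tx).
  by rewrite subrr.
- by rewrite (min_idPr (le_trans ys st)) subrr.
Qed.

Lemma near_sqrt_ge (M : R) : \forall n \near \oo, M <= Num.sqrt n%:R.
Proof.
near=> n; rewrite (le_trans (ler_norm M))// -sqrtr_sqr ler_wsqrtr//.
by near: n; exact: nbhs_infty_ger.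
Unshelve. all: by end_near. Qed.

(** Summing [freq_cell_cross] over [k] in the window and [l] among the selected indices bounds
    window mass times selected cells by [expR (K / r)] times selected mass times window cells. The
    window cells total at most 1, and [window_mass] makes the window mass nearly full. *)
Lemma near_mass_ge (x y e : R) : x <= y -> 0 < e ->
  \forall n \near \oo, Phi y - Phi x - e <=
    (\sum_(k < n.+2 | (x <= zscore n k.+1) && (zscore n k < y)) freq n k) / power_sum R 0 n.
Proof.
move=> xy e0.
(* The term [82 / e] makes the Chebyshev loss at most [e / 2]; the others keep every selected
   [zscore n k] in the window, since a cell has width at most 4. *)
pose T := 5 + `|x| + `|y| + 82 / e.
have e82 : 0 < 82 / e by rewrite divr_gt0.
have x0 := normr_ge0 x; have y0 := normr_ge0 y.
have T5 : 5 <= T by rewrite /T; lra.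
have Te : 41 / T ^+ 2 <= e / 2.
  have T0 : 0 < T by lra.
  rewrite ler_pdivrMr ?exprn_gt0//.
  have h : 82 <= e * T.
    have : e * (82 / e) = 82 by field; rewrite gt_eqF.
    have : 82 / e <= T by rewrite /T; lra.
    nra.
  nra.
pose K := 8 * (T + 4) + 660 * T ^+ 3.
have l0 : 0 < ln (1 + e / 2) by rewrite ln_gt0; lra.
near=> n.
have r1 : 18 * T <= Num.sqrt n%:R by near: n; exact: near_sqrt_ge.
have r2 : K / ln (1 + e / 2) <= Num.sqrt n%:R by near: n; exact: near_sqrt_ge.
set r := Num.sqrt n%:R in r1 r2.
have r0 : 1 <= r by lra.
have rn : r ^+ 2 = n%:R by rewrite sqr_sqrtr.
have n0 : (0 < n)%N by rewrite -(ltr0n R) -rn exprn_gt0//; lra.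
have s0 := scale_gt0 R _ n0; have /andP[_ sr] := scale_bounds R n.
have T1 : 1 <= T by lra.
have /andP[h0 h4] := inv_scale_le _ r0; rewrite -/r in h4 sr.
have h1 : (scale n)^-1 <= 4 by rewrite (le_trans h4)// ler_pdivrMr; lra.
have EK : expR (K / r) <= 1 + e / 2.
  rewrite -[leRHS]lnK ?posrE; last lra.
  rewrite ler_expR ler_pdivrMr; last lra.
  by move: r2; rewrite ler_pdivrMr// mulrC.
have x1 := ler_norm (- x); have y1 := ler_norm y; rewrite normrN in x1.
have xx := ler_norm x; have yy := ler_norm (- y); rewrite normrN in yy.
have inW k : (x <= zscore n k.+1) && (zscore n k < y) -> `|zscore n k| <= T.
  by rewrite zscoreS ler_norml => /andP[? ?]; apply/andP; rewrite /T; split; lra.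
have z0 : zscore n 0 <= x.
  rewrite /zscore ler_pdivrMr// sub0r -rn.
  have : - (`|x| * r) <= x * scale n by nra.
  by rewrite /T in r1; nra.
have zN : y <= zscore n n.+2.
  rewrite /zscore ler_pdivlMr// -[n.+2%:R]natr1 -[n.+1%:R]natr1 -rn.
  have : y * scale n <= `|y| * r by nra.
  have : 18 * `|y| * r <= r * r by rewrite ler_wpM2r//; rewrite /T in r1; lra.
  by have := sqr_ge0 r; lra.
have cells := sum_cell_ge _ _ _ xy z0 zN.
have mass := window_mass _ _ n0 (lt_le_trans ltr01 T1).
have Z0 := power_sum0_gt0 R n.
set S := \sum_(k < n.+2 | _) freq n k; set Z := power_sum R 0 n in mass Z0 *.
set C := \sum_(k < n.+2 | _) _ in cells.
set M := \sum_(k < n.+2 | _) _ in mass.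
have S0 : 0 <= S by apply: sumr_ge0.
have cross : M * C <= expR (K / r) * S.
  pose D := \sum_(k < n.+2 | `|zscore n k| <= T) cell n k.
  have : M * C <= expR (K / r) * (S * D).
    rewrite /M /C /S /D !big_distrlr /= mulr_sumr exchange_big /=.
    apply: ler_sum => l lS; rewrite mulr_sumr; apply: ler_sum => k kW.
    exact: freq_cell_cross (inW l lS).
  move=> /le_trans; apply; rewrite ler_wpM2l ?expR_ge0//.
  by rewrite ler_piMr// sum_cell_le1.
rewrite ler_pdivlMr//.
have P1 := Phi_ge0 R x; have P2 := Phi_le1 R y; have P3 := le_Phi R _ _ xy.
have eS : M * C <= (1 + e / 2) * S by rewrite (le_trans cross)// ler_wpM2r.
(* A nonpositive bound is trivial; otherwise [e < 1], which keeps [1 - e / 2] positive. *)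
have [De|De] := leP (Phi y - Phi x - e) 0.
  by rewrite (le_trans _ S0)// mulr_le0_ge0// ltW.
have e1 : e < 1 by lra.
set d := Phi y - Phi x in cells De *.
have MZ : (1 - e / 2) * Z <= M.
  by rewrite (le_trans _ mass)// ler_wpM2r//; [exact: ltW | lra].
have MC : (1 - e / 2) * Z * d <= M * C by rewrite ler_pM// ?mulr_ge0//; rewrite /d; lra.
rewrite -(ler_pM2l (_ : 0 < 1 + e / 2)); last lra.
rewrite (le_trans _ eS)// (le_trans _ MC)//.
rewrite mulrA [_ * Z * d]mulrAC ler_wpM2r ?(ltW Z0)//.
(* What remains is [(1 + e / 2) * (d - e) <= (1 - e / 2) * d], which follows from [d <= 1]. *)
have : d <= 1 by rewrite /d; lra.
nra.
Unshelve. all: by end_near. Qed.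

End LowerBound.

(** * Passage to the exact standardisation and convergence of distribution functions *)

Section Limit.
Variable R : realType.
Implicit Types (n k : nat) (x e d : R).
Local Notation zscore := (zscore R).
Local Notation scale := (scale R).
Local Notation freq n k := ((count_legals n k)%:R : R).

(** The identity as a random variable under the normal law, so that the limits of [cdf] at infinity
    apply to [Phi]. *)
Let idTR : measurableTypeR R -> R := idfun.

#[local] HB.instance Definition _ :=
  @isMeasurableFun.Build _ _ _ _ idTR (@measurable_id _ _ setT).

Lemma Phi_tails e : 0 < e ->
  exists2 A : R, 0 < A & forall t : R, A < t -> Phi (- t) <= e /\ 1 - e <= Phi t.
Proof.
move=> e0.
pose Q : probability (measurableTypeR R) R := normal_prob 0 1.
pose X : {RV Q >-> R} := idTR.
have /fine_cvg/cvgrPdist_le/(_ _ e0)[A [_ hA]] : cdf X @ +oo --> 1%:E by exact: cvg_cdfy1.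
have /fine_cvg/cvgrPdist_le/(_ _ e0)[B [_ hB]] : cdf X @ -oo --> 0%:E by exact: cvg_cdfNy0.
have A0 := ler_norm A; have B0 := ler_norm (- B); rewrite normrN in B0.
have A1 := normr_ge0 A; have B1 := normr_ge0 B.
exists (1 + `|A| + `|B|); first lra.
move=> t ht; split.
  have tB : - t < B by lra.
  have : `|0 - Phi (- t)| <= e := hB _ tB.
  by rewrite sub0r normrN; apply: le_trans; exact: ler_norm.
have At : A < t by lra.
have : `|1 - Phi t| <= e := hA _ At.
by rewrite ler_norml => /andP[_]; lra.
Qed.

Lemma sqr_le_exp2 n : (n ^ 2 <= 2 * 2 ^ n)%N.
Proof.
(* The induction starts at 3, from which on [(n + 1) ^ 2 <= 2 * n ^ 2]. *)
do 3 (case: n => [//|n]).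
elim: n => [//|n IH]; rewrite [X in (_ <= 2 * X)%N]expnS; nia.
Qed.

Lemma avg_near n : (0 < n)%N -> `|avg R n - n%:R / 3| <= 2.
Proof.
move=> n0; have := avg_asymptotics R _ n0.
have X1 := pow2_ge1 R n; have nX := natr_le_exp2 R n.
have : n%:R / 2 ^+ n <= 1 :> R by rewrite ler_pdivrMr; lra.
by rewrite !ler_norml => ? /andP[? ?]; apply/andP; split; lra.
Qed.

(** The squares of the two scales differ by a bounded amount, and [scale n] is at least [18 / 4]; so
    the scales differ by a bounded amount too. *)
Lemma sqrt_variation_near n : 18 <= Num.sqrt n%:R :> R ->
  0 < Num.sqrt (variation R n) /\ `|scale n - Num.sqrt (variation R n)| <= 3.
Proof.
move=> r18; have /andP[s1 _] := scale_bounds R n.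
have rn : Num.sqrt n%:R ^+ 2 = n%:R :> R by rewrite sqr_sqrtr.
have nR : 324 <= n%:R :> R by rewrite -[leRHS]rn; nra.
have n0 : (0 < n)%N by rewrite -(ltr0n R); lra.
have X1 := pow2_ge1 R n.
have q : n%:R ^+ 2 / 2 ^+ n <= 2 :> R.
  rewrite ler_pdivrMr; last lra.
  by rewrite -!natrX -natrM ler_nat sqr_le_exp2.
have := variation_asymptotics R _ n0; rewrite ler_norml => /andP[v1 v2].
have v0 : 0 < variation R n by lra.
split; first by rewrite sqrtr_gt0.
have := sqr_sqrtr (ltW v0); have := sqr_scale R n.
have := sqrtr_ge0 (variation R n).
have s1' : 1 <= scale n by lra.
clear -v1 v2 q s1'.
move: (Num.sqrt (variation R n)) (scale n) s1' => w s s1' w0 S W.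
rewrite ler_norml; apply/andP; split; nra.
Qed.

Lemma near_cdf_sandwich x d : 0 < d ->
  \forall n \near \oo, forall k,
    (zscore n k < x - d -> (k%:R - avg R n) / Num.sqrt (variation R n) <= x) /\
    (x + d <= zscore n k.+1 -> x < (k%:R - avg R n) / Num.sqrt (variation R n)).
Proof.
move=> d0; near=> n.
have r18 : 18 <= Num.sqrt n%:R :> R by near: n; exact: near_sqrt_ge.
have rd : 4 * (3 * `|x| + 4) / d <= Num.sqrt n%:R by near: n; exact: near_sqrt_ge.
have rn : Num.sqrt n%:R ^+ 2 = n%:R :> R by rewrite sqr_sqrtr.
have n0 : (0 < n)%N by rewrite -(ltr0n R) -[ltRHS]rn exprn_gt0//; lra.
have [w0 ws] := sqrt_variation_near _ r18.
have mu := avg_near _ n0.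
have /andP[s1 _] := scale_bounds R n.
(* The shift [d * scale n] absorbs the scale error [3 * |x|], the mean error 2 and the unit gap
   between [k] and [k.+1], with one unit left for strictness. *)
have ds : 3 * `|x| + 4 <= d * scale n.
  by rewrite -ler_pdivrMl// mulrC; lra.
have xw : `|x * (scale n - Num.sqrt (variation R n))| <= 3 * `|x|.
  by rewrite normrM mulrC ler_wpM2r.
move: mu xw; rewrite !ler_norml => /andP[m1 m2] /andP[x1 x2] k.
have s0 : 0 < scale n by lra.
rewrite ler_pdivrMr// ltr_pdivlMr//; split => h.
  have : zscore n k * scale n <= (x - d) * scale n by rewrite ler_wpM2r ?ltW.
  by rewrite zscoreK//; lra.
have : (x + d) * scale n <= zscore n k.+1 * scale n by rewrite ler_pM2r.
by rewrite zscoreK// -[k.+1%:R]natr1; lra.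
Unshelve. all: by end_near. Qed.

(** [near_mass_ge] is applied on either side of [x], on bounded intervals cut at [- t] and [t]. The
    error splits into three parts [e]: the mass bound, the tail beyond the cut, and the continuity
    of [Phi] at [x]. *)
Lemma cvg_cdf_Phi x : {for x, continuous (@Phi R)} ->
  (\sum_(s <- legals n)
      (((size s)%:R - avg R n) / Num.sqrt (variation R n) <= x)%R%:R) /
    power_sum R 0 n @[n --> \oo] --> Phi x.
Proof.
move=> cx; apply/cvgrPdist_le => e0 e00.
pose e := e0 / 3; have e_gt0 : 0 < e by rewrite /e; lra.
have /cvgrPdist_le/(_ _ e_gt0)/nbhs_ballP[d' /= d'0 hd'] := cx.
pose d := d' / 2; have d0 : 0 < d by rewrite /d; lra.
have hd t : `|x - t| <= d -> `|Phi x - Phi t| <= e.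
  by move=> xt; apply: hd'; rewrite /ball /= (le_lt_trans xt)// /d; lra.
have [A A0 hA] := Phi_tails _ e_gt0.
pose t := A + `|x| + d + 1.
have xx := ler_norm x; have xN := ler_norm (- x); rewrite normrN in xN.
have [tl tr] : Phi (- t) <= e /\ 1 - e <= Phi t.
  by apply: hA; rewrite /t; have := normr_ge0 x; lra.
have l1 : - t <= x - d by rewrite /t; lra.
have l2 : x + d <= t by rewrite /t; lra.
have c1 : `|Phi x - Phi (x - d)| <= e by apply: hd; rewrite subKr gtr0_norm.
have c2 : `|Phi x - Phi (x + d)| <= e.
  by apply: hd; rewrite opprD addNKr normrN gtr0_norm.
near=> n.
have sand : forall k,
    (zscore n k < x - d -> (k%:R - avg R n) / Num.sqrt (variation R n) <= x) /\
    (x + d <= zscore n k.+1 -> x < (k%:R - avg R n) / Num.sqrt (variation R n)).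
  by near: n; exact: near_cdf_sandwich.
have low : Phi (x - d) - Phi (- t) - e <=
    (\sum_(k < n.+2 | (- t <= zscore n k.+1) && (zscore n k < x - d)) freq n k)
      / power_sum R 0 n.
  by near: n; exact: near_mass_ge.
have upp : Phi t - Phi (x + d) - e <=
    (\sum_(k < n.+2 | (x + d <= zscore n k.+1) && (zscore n k < t)) freq n k)
      / power_sum R 0 n.
  by near: n; exact: near_mass_ge.
have Z0 := power_sum0_gt0 R n.
rewrite (sum_legals_by_size R
  (fun k => ((k%:R - avg R n) / Num.sqrt (variation R n) <= x)%R%:R)).
set F := \sum_(k < n.+2) _ * _.
set S1 := \sum_(k < n.+2 | _) _ in low; set S2 := \sum_(k < n.+2 | _) _ in upp.
have F1 : S1 / power_sum R 0 n <= F / power_sum R 0 n.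
  rewrite ler_pM2r ?invr_gt0// /S1 big_mkcond; apply: ler_sum => k _.
  case: ifP => [/andP[_ /(sand k).1 ->]|_]; first by rewrite mul1r.
  by rewrite mulr_ge0.
(* An index counted in [S2] standardises above [x], so [F] does not count it: the lower bound on the
   right becomes an upper bound for [F]. *)
have F2 : S2 / power_sum R 0 n + F / power_sum R 0 n <= 1.
  rewrite -mulrDl ler_pdivrMr// mul1r -sum_freq /S2 big_mkcond -big_split.
  apply: ler_sum => k _ /=.
  case: ifP => [/andP[/(sand k).2 h _]|_]; first by rewrite (lt_geF h) mul0r addr0.
  by rewrite add0r ler_piMl// lern1 leq_b1.
have e3 : e0 = 3 * e by rewrite /e; field.
move: c1 c2; rewrite !ler_norml => /andP[? ?] /andP[? ?].
by apply/andP; split; lra.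
Unshelve. all: by end_near. Qed.

End Limit.

Theorem theorem1p3 (R : realType) (a : nat -> nat) (ha : kentucky2 a) :
  let P : nat -> probability nat R := fun n => uniform_below R (a (2 * n + 1)%N) in
  let Y : forall n, {RV (P n) >-> R} := fun n => num_summands R a in
  let mu : nat -> R := fun n => mean (P n) (Y n) in
  let sigma2 : nat -> R := fun n => var (P n) (Y n) in
  [/\ mu = (fun n => n%:R / 3 + 2 / 9) +O_\oo (fun n => n%:R / 2 ^+ n : R),
      sigma2 = (fun n => 2 * n%:R / 27 + 8 / 81)
                 +O_\oo (fun n => n%:R ^+ 2 / 2 ^+ n : R)
    & cvg_in_distribution P (fun n => standardized (P n) (Y n)) (normal_prob 0 1)].
Proof.
move=> P Y mu sigma2; split.
- apply/eqaddOP; near=> c; near=> n.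
  rewrite [X in `|X|](_ : _ = avg R n - (n%:R / 3 + 2 / 9)); last first.
    by rewrite -(mean_num_summands R a ha).
  have n0 : (0 < n)%N by near: n; exact: nbhs_infty_gt.
  rewrite (le_trans (avg_asymptotics R _ n0))// ger0_norm ?divr_ge0// ?exprn_ge0//.
  by rewrite ler_peMl ?divr_ge0// ?exprn_ge0.
- apply/eqaddOP; near=> c; near=> n.
  rewrite [X in `|X|](_ : _ = variation R n - (2 * n%:R / 27 + 8 / 81)); last first.
    by rewrite -(var_num_summands R a ha).
  have n0 : (0 < n)%N by near: n; exact: nbhs_infty_gt.
  rewrite (le_trans (variation_asymptotics R _ n0))// ger0_norm ?divr_ge0// ?exprn_ge0//.
  by rewrite ler_peMl ?divr_ge0// ?exprn_ge0.
move=> x cx.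
(* The continuity assumed for extended-real values passes to the real-valued [Phi]. *)
have cPhi : {for x, continuous (@Phi R)} by apply: fine_cvg; rewrite -normal_prob_PhiE.
rewrite [X in _ --> X](_ : _ = (Phi x)%:E); last exact: normal_prob_PhiE.
under eq_fun do rewrite (cdf_standardized R a ha).
by apply: cvg_EFin; [exact: nearW | exact: cvg_cdf_Phi].
Unshelve. all: by end_near. Qed.
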